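(* There exists an absolute constant $C>0$ such that for every positive integer $d$, $$G(d)\geq \frac{1}{2}\bigl(1+\exp(-Cd)\bigr).$$
   Context: A digraph $G$ has a vertex set $V$ and an edge set $E(G)$ of ordered pairs $xy$ of distinct vertices; both $xy$ and $yx$ may be edges. A directed triangle is a directed cycle of length 3, i.e. three distinct vertices $x,y,z$ with $xy,yz,zx$ all edges. A digraph $G$ on a vertex set $V\subset\mathbb{R}^d$ is unit distance if every edge $xy\in E(G)$ satisfies $\|x-y\|_2=1$. Let $\bar t(G)$ denote the maximum number of edges in a subgraph of $G$ containing no directed triangle. Define $$G(d)=\inf\left\{\frac{\bar t(G)}{|E(G)|} : G \text{ is a finite unit distance digraph in } \mathbb{R}^d,\ |E(G)|>0\right\}.$$ *)

(* Defs.v *)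
From HB Require Import structures.
From mathcomp Require Import all_boot all_order all_algebra.
From mathcomp Require Import finmap.
From mathcomp Require Import all_classical all_reals all_analysis.

Set Implicit Arguments.
Unset Strict Implicit.
Unset Printing Implicit Defensive.

Import Order.TTheory GRing.Theory Num.Theory.

Local Open Scope ring_scope.

Record digraph (V : finType) := Digraph {
  edges : {set V * V};
  edges_loopless : forall x : V, (x, x) \notin edges
}.

Definition has_directed_triangle (V : finType) (F : {set V * V}) : bool :=
  [exists x : V, exists y : V, exists z : V,
    [&& uniq [:: x; y; z], (x, y) \in F, (y, z) \in F & (z, x) \in F]].

(* Only the edge set of a subgraph matters here, since isolated vertices change
   neither the number of edges nor the existence of a directed triangle; so
   subgraphs range over the subsets of the edge set.  The empty subset always
   qualifies, hence the maximum is attained. *)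
Definition tbar (V : finType) (G : digraph V) : nat :=
  \max_(F : {set V * V} | (F \subset edges G) && ~~ has_directed_triangle F)
    #|F|.

(* The library norm on row vectors is the sup norm. *)
Definition l2norm (R : realType) (d : nat) (u : 'rV[R]_d) : R :=
  Num.sqrt (\sum_(i < d) u 0 i ^+ 2).

Definition unit_distance (R : realType) (d : nat) (V : {fset 'rV[R]_d})
    (G : digraph V) : Prop :=
  forall x y : V, (x, y) \in edges G -> l2norm (fsval x - fsval y) = 1.

(* The set below is bounded below by 0, and it is nonempty when 0 < d, so [inf]
   is then the genuine infimum; for d = 0 the set is empty. *)
Definition Gdim (R : realType) (d : nat) : R :=
  inf [set q : R | exists (V : {fset 'rV[R]_d}) (G : digraph V),
    [/\ unit_distance G, (0 < #|edges G|)%N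
      & q = (tbar G)%:R / #|edges G|%:R]].

(* Main.v *)
Require Import Defs.
From mathcomp Require Import all_boot all_order all_algebra finmap.
From mathcomp Require Import all_classical all_reals all_analysis.
From mathcomp Require Import ring lra zify.

(** The unit-distance graph of a finite subset of R^d has a proper colouring with
    k <= exp(O(d)) colours: cut R^d into cubes of side 1/sqrt d, which contain no
    unit distance, and colour the cubes greedily; a cube sees only exp(O(d))
    others at unit distance, since Z^d has only exp(O(d)) points of l1 norm
    O(d).  Some pair of colours then carries at least a fraction 1/k^2 of the
    edges.  Merge these two colours, order the resulting classes and keep either
    all edges that do not go down or all those that do not go up.  No directed
    triangle survives, since it would lie in one class, which is bipartite; and
    as the edges inside the merged class are kept both times, the better choice
    keeps a fraction of at least (1 + 1/k^2) / 2. *)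

Set Implicit Arguments.
Unset Strict Implicit.
Unset Printing Implicit Defensive.
Import Order.TTheory GRing.Theory Num.Theory.
Local Open Scope ring_scope.

(** * Colouring graphs of bounded degree *)

(** Induction on [s]: the neighbours of the head within the tail use at most [k] of the [k.+1]
    colours, so one colour stays free for the head. *)
Lemma greedy_colouring (T : eqType) (e : rel T) (k : nat) (s : seq T) :
  symmetric e -> uniq s -> {in s, forall x, (count (e x) s <= k)%N} ->
  exists c : T -> 'I_k.+1, {in s &, forall x y, x != y -> e x y -> c x != c y}.
Proof.
move=> e_sym; elim: s => [|x s IHs] /=; first by exists (fun=> ord0).
case/andP=> x_s s_uniq deg.
have [|c c_ok] := IHs s_uniq.
  move=> y y_s; apply: leq_trans (leq_addl _ _) (deg y _).
  by rewrite inE y_s orbT.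
pose used := [seq c y | y <- s & e x y].
have [a a_used] : exists a, a \notin used.
  apply/existsP; apply: contraT; rewrite negb_exists => /forallP all_used.
  have : (#|'I_k.+1| <= size used)%N.
    apply: leq_trans (card_size used); apply/subset_leq_card/fintype.subsetP.
    by move=> a _; move: (all_used a); rewrite negbK.
  rewrite card_ord size_map size_filter ltnNge => /negP[].
  by apply: leq_trans (leq_addl _ _) (deg x (mem_head _ _)).
have a_free y : y \in s -> e x y -> a != c y.
  move=> y_s exy; apply: contra a_used => /eqP ->.
  by apply: map_f; rewrite mem_filter exy.
exists (fun y => if y == x then a else c y) => y z.
rewrite !inE; case: (eqVneq y x) => [->|yx] /=; case: (eqVneq z x) => [->|zx] //=.
- by move=> _ z_s _; apply: a_free.
- by move=> y_s _ _; rewrite e_sym eq_sym; apply: a_free.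
- exact: c_ok.
Qed.

(** * Lattice points in an l1 ball *)

Lemma sum_halves_le n : \sum_(j < n) (2^-1 : rat) ^+ j <= 2.
Proof.
suff -> : \sum_(j < n) (2^-1 : rat) ^+ j = 2 - 2 * 2^-1 ^+ n.
  by rewrite gerBl mulr_ge0 // exprn_ge0 // invr_ge0.
elim: n => [|n IHn]; first by rewrite big_ord0 expr0; lra.
by rewrite big_ord_recr /= IHn exprS; lra.
Qed.

Definition l1dist (d : nat) (v w : {ffun 'I_d -> int}) : nat :=
  \sum_(i < d) `|v i - w i|%N.

(* Weighting each vector by [2^-(l1 norm)] makes the total weight factor over
   the coordinates; every vector counted here has weight at least [2^-n]. *)
Lemma card_l1ball (d n : nat) (v : {ffun 'I_d -> int})
    (s : seq {ffun 'I_d -> int}) :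
  uniq s -> {in s, forall w, (l1dist v w <= n)%N} ->
  (size s <= 2 ^ n * 4 ^ d)%N.
Proof.
move=> s_uniq s_ball.
(* Recording each coordinate as a distance to [v i] and a sign bit places the ball in a finite type
   of functions, over which a sum of products factors. *)
pose code (w : {ffun 'I_d -> int}) : {ffun 'I_d -> 'I_n.+1 * bool} :=
  [ffun i => (inord `|v i - w i|%N, v i <= w i)].
have coord_le w i : w \in s -> (`|v i - w i|%N <= n)%N.
  move=> /s_ball; apply: leq_trans.
  by rewrite /l1dist (bigD1 i) //= leq_addr.
have code_inj : {in s &, injective code}.
  move=> w w' w_s w'_s /ffunP eq_code; apply/ffunP => i.
  move: (eq_code i); rewrite !ffunE => -[/(congr1 val)] /=.
  by rewrite !inordK ?ltnS ?coord_le // => ? ?; lia.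
pose A := [set f : {ffun 'I_d -> 'I_n.+1 * bool} |
            (\sum_(i < d) (f i).1 <= n)%N]%SET.
have size_A : (size s <= #|A|)%N.
  rewrite -(size_map code) -(card_uniqP _) ?map_inj_in_uniq //.
  apply/subset_leq_card/fintype.subsetP => f /mapP[w w_s ->]; rewrite inE.
  rewrite (eq_bigr (fun i => `|v i - w i|%N)) ?s_ball // => i _.
  by rewrite ffunE /= inordK // ltnS coord_le.
apply: leq_trans size_A _.
rewrite -(ler_nat rat) natrM !natrX.
pose wt (p : 'I_n.+1 * bool) : rat := 2^-1 ^+ p.1.
have wt_ge0 p : 0 <= wt p by rewrite exprn_ge0 // invr_ge0.
have total : \sum_(f : {ffun 'I_d -> 'I_n.+1 * bool}) \prod_i wt (f i) <= 4 ^+ d.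
  rewrite -(bigA_distr_bigA (fun=> wt)) prodr_const card_ord.
  apply: lerXn2r; rewrite ?nnegrE ?sumr_ge0 //.
  (* For each of the two signs the distances contribute a geometric sum of at most 2, hence the
     factor 4 per coordinate. *)
  rewrite -(pair_bigA _ (fun (j : 'I_n.+1) (b : bool) => wt (j, b))) /=.
  rewrite exchange_big big_bool /wt /=.
  by have := sum_halves_le n.+1; lra.
have : #|A|%:R * 2^-1 ^+ n <= (4 : rat) ^+ d.
  apply: le_trans total; rewrite mulr_natl -sumr_const.
  rewrite [leRHS](bigID (mem A)) /= -[leLHS]addr0; apply: lerD.
    apply: ler_sum => f; rewrite inE /wt /= -expr_sum => f_le.
    by rewrite ler_wiXn2l ?invr_ge0 ?invf_le1.
  by apply: sumr_ge0 => f _; apply: prodr_ge0.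
by rewrite exprVn ler_pdivrMr ?exprn_gt0 // mulrC.
Qed.

(** * From a proper colouring to a triangle-free subgraph *)

Lemma tbar_colouring (V : finType) (G : digraph V) (k : nat) (c : V -> 'I_k) :
  (forall x y, (x, y) \in edges G -> c x != c y) ->
  (#|edges G| * (k ^ 2).+1 <= 2 * tbar G * k ^ 2)%N.
Proof.
move=> c_ok; set E := edges G.
pose cc (p : V * V) := (c p.1, c p.2).
pose class ab := [set p in E | cc p == ab]%SET.
have [E0|/set0Pn[p0 p0E]] := eqVneq E finset.set0.
  by rewrite E0 cards0.
pose ab := [arg max_(q > cc p0) #|class q|].
have class_max q : (#|class q| <= #|class ab|)%N.
  by rewrite /ab; case: arg_maxnP => // i _; apply.
have pigeon : (#|E| <= k ^ 2 * #|class ab|)%N.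
  rewrite -sum1_card (partition_big cc xpredT) //=.
  apply: (@leq_trans (\sum_(q : 'I_k * 'I_k) #|class ab|)%N).
    apply: leq_sum => q _; apply: leq_trans (class_max q).
    rewrite sum1dep_card; apply/subset_leq_card/fintype.subsetP => p.
    by rewrite !inE.
  by rewrite sum_nat_const card_prod card_ord mulnn.
(* The colour [ab.2] moves to the level of [ab.1]; the other colours keep levels of their own. *)
pose lev (i : 'I_k) : nat := if i == ab.2 then ab.1 else i.
have triangle_free (F : {set V * V}) : F \subset E ->
    (forall x y z, (x, y) \in F -> (y, z) \in F -> (z, x) \in F ->
       lev (c x) = lev (c y) /\ lev (c y) = lev (c z)) ->
    (#|F| <= tbar G)%N.
  move=> FE levF; apply: leq_bigmax_cond; rewrite FE /=.
  (* The vertices of a triangle have pairwise different colours, but a single level holds at most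
     two colours. *)
  apply/existsP => -[x /existsP[y /existsP[z /and4P[_ xy yz zx]]]].
  have [] := levF x y z xy yz zx.
  have c_neq p q : (p, q) \in F -> c p != c q.
    by move=> /(fintype.subsetP FE) /c_ok.
  move: (c_neq _ _ xy) (c_neq _ _ yz) (c_neq _ _ zx); rewrite /lev.
  by rewrite -!val_eqE /= => /eqP ? /eqP ? /eqP ?; do 3! case: eqP => ?; lia.
pose F1 := [set p in E | (lev (c p.1) <= lev (c p.2))%N]%SET.
pose F2 := [set p in E | (lev (c p.2) <= lev (c p.1))%N]%SET.
have F1_le : (#|F1| <= tbar G)%N.
  apply: triangle_free => [|x y z].
    by apply/fintype.subsetP => p; rewrite inE => /andP[].
  by rewrite !inE /= => /andP[_ ?] /andP[_ ?] /andP[_ ?]; lia.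
have F2_le : (#|F2| <= tbar G)%N.
  apply: triangle_free => [|x y z].
    by apply/fintype.subsetP => p; rewrite inE => /andP[].
  by rewrite !inE /= => /andP[_ ?] /andP[_ ?] /andP[_ ?]; lia.
have F12U : F1 :|: F2 = E.
  by apply/finset.setP => p; rewrite !inE -andb_orr leq_total andbT.
have F12I : (#|class ab| <= #|F1 :&: F2|)%N.
  apply/subset_leq_card/fintype.subsetP => p; rewrite !inE => /andP[-> /eqP cp].
  by rewrite /lev -cp /= eqxx; case: ifP => _; rewrite leqnn.
have := cardsUI F1 F2; rewrite F12U => cardF.
have : (#|E| + #|class ab| <= 2 * tbar G)%N by lia.
rewrite -(leq_pmul2r (_ : 0 < k ^ 2)%N); first by nia.
(* The existence of a colour in ['I_k] excludes [k = 0]. *)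
by rewrite expn_gt0; case: (k) (c p0.1) => [[]|].
Qed.

(** * Cubes of side 1/sqrt d *)

(** With t = a - b, the floors differ by less than |t| + 1, and 2|t| <= 1 + t^2. A bound quadratic
    in t can be summed over coordinates against the Euclidean norm. *)
Lemma floor_dist_le (R : realType) (a b : R) :
  (`|Num.floor a - Num.floor b|%N%:R : R) <= 2 + 2 * (a - b) ^+ 2.
Proof.
rewrite natr_absz intr_norm rmorphB /=.
have := Num.Theory.floor_itv a; have := Num.Theory.floor_itv b.
rewrite !intrD => /andP[? ?] /andP[? ?].
have := sqr_ge0 (a - b - 1); have := sqr_ge0 (a - b + 1); have := sqr_ge0 (a - b).
by rewrite ler_norml !expr2 => ? ? ?; apply/andP; split; lra.
Qed.

Definition cell (R : realType) (d : nat) (u : 'rV[R]_d) : {ffun 'I_d -> int} :=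
  [ffun i => Num.floor (Num.sqrt d%:R * u 0 i)].

Lemma sum_sqr_scaled (R : realType) (d : nat) (u : 'rV[R]_d) :
  l2norm u = 1 -> \sum_i (Num.sqrt d%:R * u 0 i) ^+ 2 = d%:R.
Proof.
move=> u1; under eq_bigr => i _ do rewrite exprMn sqr_sqrtr ?ler0n //.
rewrite -mulr_sumr -[X in _ * X]sqr_sqrtr.
  by rewrite -/(l2norm u) u1 expr1n mulr1.
by apply: sumr_ge0 => i _; exact: sqr_ge0.
Qed.

Lemma cell_l1dist (R : realType) (d : nat) (u v : 'rV[R]_d) :
  l2norm (u - v) = 1 -> (l1dist (cell u) (cell v) <= 4 * d)%N.
Proof.
move=> /sum_sqr_scaled uv; rewrite -(ler_nat R) natr_sum.
have -> : (4 * d)%N%:R =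
    \sum_(i < d) (2 + 2 * (Num.sqrt d%:R * (u - v) 0 i) ^+ 2) :> R.
  by rewrite big_split /= -mulr_sumr uv sumr_const card_ord -mulr_natl natrM; lra.
apply: ler_sum => i _; rewrite !ffunE !mxE mulrBr; exact: floor_dist_le.
Qed.

(** Cubes are half-open, so within one cube every scaled coordinate difference is strictly below 1
    in absolute value and the squares sum to less than d. *)
Lemma cell_neq (R : realType) (d : nat) (u v : 'rV[R]_d) :
  (0 < d)%N -> l2norm (u - v) = 1 -> cell u != cell v.
Proof.
move=> d_gt0 /sum_sqr_scaled uv; apply/eqP => /ffunP cells.
have : \sum_i (Num.sqrt d%:R * (u - v) 0 i) ^+ 2 < \sum_(i < d) (1 : R).
  apply: ltr_sum => [|i _].
    by apply/hasP; exists (Ordinal d_gt0); rewrite // mem_index_enum.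
  rewrite !mxE mulrBr; move: (cells i); rewrite !ffunE.
  set a := _ * _; set b := _ * _ => eq_floor.
  have := Num.Theory.floor_itv a; have := Num.Theory.floor_itv b.
  by rewrite eq_floor !intrD => /andP[? ?] /andP[? ?]; nra.
by rewrite uv sumr_const card_ord ltxx.
Qed.

Lemma unit_distance_tbar (R : realType) (d : nat) (V : {fset 'rV[R]_d})
    (G : digraph V) :
  (0 < d)%N -> unit_distance G ->
  (#|edges G| * ((64 ^ d).+1 ^ 2).+1 <= 2 * tbar G * (64 ^ d).+1 ^ 2)%N.
Proof.
move=> d_gt0 unitG.
(* This relation on cube indices covers every pair of cubes containing points at unit distance. *)
pose near (v w : {ffun 'I_d -> int}) := (l1dist v w <= 4 * d)%N.
have near_sym : symmetric near.
  by move=> v w; congr (_ <= _)%N; apply: eq_bigr => i _; lia.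
have [|c c_ok] := greedy_colouring (k := 64 ^ d) near_sym
  (undup_uniq [seq cell (fsval x) | x : V]).
  move=> v _; rewrite -size_filter.
  (* The ball bound at radius 4d gives the degree bound. *)
  have -> : (64 ^ d = 2 ^ (4 * d) * 4 ^ d)%N by rewrite expnM -expnMn.
  apply: (@card_l1ball _ _ v); first by rewrite filter_uniq ?undup_uniq.
  by move=> w; rewrite mem_filter => /andP[].
apply: (tbar_colouring (c := fun x : V => c (cell (fsval x)))) => x y xyE.
have xy1 := unitG x y xyE.
by apply: c_ok; rewrite ?mem_undup ?codom_f ?cell_neq //; apply: cell_l1dist.
Qed.

(** Ensures that the infimum defining [Gdim] runs over a nonempty set; the witness joins 0 and a
    basis vector in both directions. *)
Lemma unit_distance_edge (R : realType) (d : nat) : (0 < d)%N ->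
  exists (V : {fset 'rV[R]_d}) (G : digraph V),
    unit_distance G /\ (0 < #|edges G|)%N.
Proof.
move=> d_gt0; pose e : 'rV[R]_d := delta_mx 0 (Ordinal d_gt0).
have l2e : l2norm e = 1.
  rewrite /l2norm (bigD1 (Ordinal d_gt0)) //= big1 ?addr0.
    by rewrite mxE !eqxx expr1n sqrtr1.
  by move=> i /negPf i0; rewrite mxE i0 andbF expr0n.
have l2N : l2norm (- e) = 1.
  by rewrite -l2e /l2norm; congr Num.sqrt; apply: eq_bigr => i _; rewrite mxE sqrrN.
have e0 : e != 0.
  apply/eqP => e0; move: l2e; rewrite e0 /l2norm big1 => [|i _].
    by rewrite sqrtr0 => /eqP; rewrite eq_sym oner_eq0.
  by rewrite mxE expr0n.
pose V := [fset 0; e]%fset.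
have loopless (x : V) : (x, x) \notin [set p : V * V | p.1 != p.2]%SET.
  by rewrite inE /= eqxx.
exists V, (Digraph loopless); split.
  move=> x y; rewrite inE /= -val_eqE /=.
  have /fset2P[->|->] := valP x; have /fset2P[->|->] := valP y.
  - by rewrite eqxx.
  - by rewrite sub0r.
  - by rewrite subr0.
  - by rewrite eqxx.
have V0 : 0 \in V by rewrite !inE eqxx.
have Ve : e \in V by rewrite !inE eqxx orbT.
apply/card_gt0P; exists ([` V0]%fset, [` Ve]%fset).
by rewrite inE /= -val_eqE /= eq_sym.
Qed.

Theorem proposition1p7 (R : realType) :
  exists C : R, 0 < C /\
    forall d : nat, (0 < d)%N ->
      2^-1 * (1 + expR (- C * d%:R)) <= Gdim R d.
Proof.
(* As 64^d + 1 <= 2^d 64^d = 128^d for positive d, this constant makes exp(-Cd) = 128^(-2d) at most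
   1/k^2. *)
exists (ln (128 ^+ 2)); split.
  by apply: ln_gt0; rewrite exprn_egt1 //; lra.
move=> d d_gt0; apply: lb_le_inf.
  have [V [G [unitG G_gt0]]] := unit_distance_edge R d_gt0.
  by exists ((tbar G)%:R / #|edges G|%:R), V, G.
move=> _ [V [G [unitG G_gt0 ->]]].
set k := (64 ^ d).+1.
have k_le : (k <= 128 ^ d)%N.
  rewrite /k (expnMn 2 64 d); apply: (@leq_trans (2 * 64 ^ d)%N).
    by rewrite mul2n -addnn -addn1 leq_add2l expn_gt0.
  by rewrite leq_mul2r (leq_exp2l 1) // d_gt0 orbT.
have exp_le : expR (- ln (128 ^+ 2) * d%:R) <= (k%:R ^+ 2)^-1 :> R.
  rewrite mulNr expRN expRM_natr lnK ?posrE ?exprn_gt0 //.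
  rewrite lef_pV2 ?posrE ?exprn_gt0 ?ltr0n //.
  by rewrite exprAC lerXn2r ?nnegrE ?exprn_ge0 // -natrX ler_nat.
have bound : #|edges G|%:R * (k%:R ^+ 2 + 1) <= 2 * (tbar G)%:R * k%:R ^+ 2 :> R.
  have := unit_distance_tbar d_gt0 unitG.
  by rewrite -(ler_nat R) -/k natrM -natr1 natrX natrM (natrM _ 2) natrX.
rewrite ler_pdivlMr ?ltr0n //.
have k2_gt0 : 0 < k%:R ^+ 2 :> R by rewrite exprn_gt0 // ltr0n.
apply: (@le_trans _ _ (2^-1 * (1 + (k%:R ^+ 2)^-1) * #|edges G|%:R)).
  by rewrite ler_wpM2r // ler_wpM2l ?invr_ge0 // lerD2l.
rewrite -(ler_pM2r k2_gt0).
have -> : 2^-1 * (1 + (k%:R ^+ 2)^-1) * #|edges G|%:R * k%:R ^+ 2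
  = 2^-1 * (#|edges G|%:R * (k%:R ^+ 2 + 1)) :> R.
  by field; rewrite lt0r_neq0.
lra.
Qed.
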